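(* If $G$ is a connected (possibly infinite) graph with $\operatorname{odw}(G)$ finite, then there is a $(1,6\operatorname{odw}(G))$-quasi-isometry from $G$ to a tree; in particular $\operatorname{ad}(G)\le 6\operatorname{odw}(G)$.
   Context: $d_G(u,v)$ denotes the length of a shortest $u$–$v$ path in $G$. A tree-decomposition of $G$ is a pair $(T,(B_t:t\in V(T)))$ where $T$ is a (possibly infinite) tree and $B_t\subseteq V(G)$, such that $V(G)=\bigcup_t B_t$; every edge has both ends in some $B_t$; and if $t_2$ lies on the $T$-path between $t_1,t_3$ then $B_{t_1}\cap B_{t_3}\subseteq B_{t_2}$. Its outer diameter is $\sup_t\max_{u,v\in B_t}d_G(u,v)$, and $\operatorname{odw}(G)$ is the minimum outer diameter over all tree-decompositions. For graphs $G,H$, a map $\phi:V(G)\to V(H)$ is an $(L,C)$-quasi-isometry if $\frac1L d_G(u,v)-C\le d_H(\phi(u),\phi(v))\le L d_G(u,v)+C$ for all $u,v\in V(G)$, and every $y\in V(H)$ satisfies $d_H(\phi(v),y)\le C$ for some $v\in V(G)$. For a tree $T$ and $\phi:V(G)\to V(T)$, the additive distortion of $(T,\phi)$ is $\sup_{u,v}|d_G(u,v)-d_T(\phi(u),\phi(v))|$; $\operatorname{ad}(G)$ is the minimum $k$ such that some tree $T$ and map $\phi:V(G)\to V(T)$ have additive distortion at most $k$. *)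

(* Defs.v *)
From HB Require Import structures.
From mathcomp Require Import all_boot all_order all_algebra.
From mathcomp Require Import all_classical all_reals ereal.
Set Implicit Arguments.
Unset Strict Implicit.
Unset Printing Implicit Defensive.
Import Order.TTheory GRing.Theory Num.Theory.
Local Open Scope classical_set_scope.
Local Open Scope ring_scope.
Local Open Scope ereal_scope.

(* Simple graphs on an arbitrary, possibly infinite, vertex type. Asking for a
   choiceType and a boolean adjacency relation is no restriction classically
   (see {classic T} and `[< P >] in boolp). *)
Record graph := Graph {
  vertex :> choiceType;
  edge : rel vertex;
  edge_sym : symmetric edge;
  edge_irr : irreflexive edge }.

(* u :: p is the vertex sequence of a path from u to v, of length size p. *)
Definition is_path (G : graph) (u v : G) (p : seq G) : bool :=
  [&& path (@edge G) u p, uniq (u :: p) & last u p == v].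

(* +oo when u and v lie in different components. *)
Definition dist (R : realType) (G : graph) (u v : G) : \bar R :=
  ereal_inf [set (size p)%:R%:E | p in [set p | is_path u v p]].

(* The null graph is not connected; in particular, trees are nonempty. *)
Definition connected_graph (G : graph) : Prop :=
  inhabited G /\ forall u v : G, exists p, is_path u v p.

Definition acyclic (G : graph) : Prop :=
  forall c : seq G, (2 < size c)%N -> ~ ucycle (@edge G) c.

Definition is_tree (T : graph) : Prop := connected_graph T /\ acyclic T.

Definition tree_decomposition (G T : graph) (B : T -> set G) : Prop :=
  [/\ is_tree T,
      \bigcup_t B t = [set: G],
      forall u v : G, edge u v -> exists t, B t u /\ B t v
    & forall (t1 t2 t3 : T) (p : seq T), is_path t1 t3 p -> t2 \in t1 :: p ->
        B t1 `&` B t3 `<=` B t2].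

(* Empty bags contribute ereal_sup set0 = -oo, i.e. they are ignored. *)
Definition outer_diameter (R : realType) (G T : graph) (B : T -> set G)
    : \bar R :=
  ereal_sup [set ereal_sup [set dist R u v | u in B t & v in B t]
            | t in [set: T]].

(* For nonempty G, outer diameters and additive distortions take values in
   the natural numbers extended with +oo, so the infima below are minima. *)
Definition odw (R : realType) (G : graph) : \bar R :=
  ereal_inf [set x | exists (T : graph) (B : T -> set G),
    tree_decomposition B /\ x = outer_diameter R B].

Definition quasi_isometry (R : realType) (L C : R) (G H : graph)
    (phi : G -> H) : Prop :=
  (forall u v : G,
     (L^-1)%:E * dist R u v - C%:E <= dist R (phi u) (phi v) /\
     dist R (phi u) (phi v) <= L%:E * dist R u v + C%:E) /\
  (forall y : H, exists v : G, dist R (phi v) y <= C%:E).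

Definition additive_distortion (R : realType) (G T : graph) (phi : G -> T)
    : \bar R :=
  ereal_sup [set `|dist R u v - dist R (phi u) (phi v)|
            | u in [set: G] & v in [set: G]].

Definition ad (R : realType) (G : graph) : \bar R :=
  ereal_inf [set k | exists (T : graph) (phi : G -> T),
    is_tree T /\ additive_distortion R phi <= k].

(* Main.v *)
(* Fix a root s and call two vertices at the same distance i from s equivalent
   if a walk joins them outside the ball of radius i - 1 around s. The classes
   form a tree, the parent of a class being the class of the neighbours closer
   to s. The projection G -> tree is 1-Lipschitz, and it shortens distances by
   at most the diameter of a class: the tree geodesic between two classes goes
   up to a common class and down again, and both halves lift to G. If G has a
   tree-decomposition with bags of diameter at most k, then the Helly property
   of subtrees bounds the diameter of a class by 3k. The constant 6 leaves room
   to use k <= 2 odw(G). *)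
Require Import Defs.
From mathcomp Require Import all_boot all_order all_algebra.
From mathcomp Require Import all_classical all_reals ereal.
From mathcomp Require Import zify lra.
Import Order.TTheory GRing.Theory Num.Theory.

Set Implicit Arguments.
Unset Strict Implicit.
Unset Printing Implicit Defensive.

(** * Walks, and their reduction to paths *)

Definition is_walk (G : graph) (u v : G) (p : seq G) : bool :=
  path (@edge G) u p && (last u p == v).

Section Walks.
Variable G : graph.
Implicit Types (u v w : G) (p q : seq G).

Lemma is_path_walk u v p : is_path u v p -> is_walk u v p.
Proof. by case/and3P=> hp _ hl; rewrite /is_walk hp. Qed.

Lemma walk_nil u : is_walk u u [::].
Proof. by rewrite /is_walk /= eqxx. Qed.

Lemma walk1 u v : edge u v -> is_walk u v [:: v].
Proof. by rewrite /is_walk /= eqxx => ->. Qed.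

Lemma walk_cat u v w p q :
  is_walk u v p -> is_walk v w q -> is_walk u w (p ++ q).
Proof.
by case/andP=> hp /eqP <- /andP [hq hw]; rewrite /is_walk cat_path hp hq last_cat.
Qed.

Lemma walk_split u v p w : is_walk u v p -> w \in u :: p ->
  exists p1 p2, [/\ p = p1 ++ p2, is_walk u w p1 & is_walk w v p2].
Proof.
move=> hp hw; case/splitPl: hw hp => p1 p2 <- /andP [].
rewrite cat_path last_cat => /andP [h1 h2] hl.
by exists p1, p2; rewrite /is_walk h1 h2 hl eqxx.
Qed.

Lemma walk_rev u v p : is_walk u v p ->
  exists q, [/\ is_walk v u q, size q = size p & v :: q =i u :: p].
Proof.
case/andP=> hp /eqP <-; exists (rev (belast u p)).
have E : last u p :: rev (belast u p) = rev (u :: p).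
  by rewrite [u :: p]lastI rev_rcons.
split; last by move=> x; rewrite E mem_rev.
- rewrite /is_walk rev_path; apply/andP; split.
    by apply: sub_path hp => x y; rewrite edge_sym.
  have := congr1 (last (last u p)) E.
  by rewrite rev_cons last_rcons /= => ->.
by rewrite size_rev size_belast.
Qed.

Lemma walk_shorten u v p : is_walk u v p ->
  exists q, [/\ is_path u v q, size q <= size p & {subset q <= p}].
Proof.
case/andP=> hp /eqP <-; case: (shortenP hp) => q hq hu hs.
have hs' : {subset q <= p} by move=> x; apply: hs.
exists q; split=> //; first by rewrite /is_path hq hu eqxx.
by apply: uniq_leq_size => //; case/andP: hu.
Qed.

End Walks.

(** * Uniqueness of paths in acyclic graphs *)

Section AcyclicGraphs.
Variable G : graph.
Hypothesis hG : acyclic G.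
Implicit Types (u v w : G) (p q : seq G).

(** Otherwise a path from [a] to [b] inside the walk closes up through [u] to a cycle with at least
    three vertices. *)
Lemma acyclic_separates u a b p : edge u a -> edge u b ->
  is_walk a b p -> u \notin a :: p -> a = b.
Proof.
move=> ea eb /walk_shorten [q [/and3P [hq uq /eqP lq] _ sq]] nu.
have nuq : u \notin a :: q.
  apply: contra nu; rewrite !inE => /orP [-> //|/sq ->]; exact: orbT.
case: q hq uq lq nuq {sq} => [//|c q] hq uq lq nuq.
case: (hG (c := [:: u, a, c & q])) => //; apply/andP; split.
  rewrite /cycle rcons_path -/(is_true _); apply/andP; split.
    by apply/andP.
  by rewrite -[last _ _]/(last a (c :: q)) lq edge_sym.
by rewrite cons_uniq nuq.
Qed.

(** The first steps [a] and [b] agree, since [p] followed by the reverse of [q] joins them avoiding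
    [u]. *)
Lemma acyclic_path_uniq u v p q : is_path u v p -> is_path u v q -> p = q.
Proof.
elim: p u q => [|a p IH] u [|b q] //=.
- by case/and3P=> _ _ /eqP <- /and3P [_ /= /andP [h _] /eqP h']; move: h; rewrite -{1}h' mem_last.
- by move=> /[swap] /and3P [_ _ /eqP <-] /and3P [_ /= /andP [h _] /eqP h']; move: h; rewrite -{1}h' mem_last.
move=> /and3P [/= /andP [ea pa] /andP [na ua] la].
move=> /and3P [/= /andP [eb pb] /andP [nb ub] lb].
have wa : is_walk a v p by rewrite /is_walk pa la.
have wb : is_walk b v q by rewrite /is_walk pb lb.
have [r [wr _ mr]] := walk_rev wb.
have eab : a = b.
  apply: (acyclic_separates ea eb (walk_cat wa wr)).
  rewrite -cat_cons mem_cat negb_or na /=.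
  by apply: contra nb => h; rewrite -mr inE h orbT.
rewrite -eab in pb ub lb *; rewrite (IH a q) //.
  by apply/and3P.
by apply/and3P.
Qed.

Lemma acyclic_path_sub_walk u v p q : is_path u v p -> is_walk u v q ->
  {subset p <= q}.
Proof.
by move=> hp /walk_shorten [r [hr _ sr]]; rewrite (acyclic_path_uniq hp hr).
Qed.

End AcyclicGraphs.

(** * Connected vertex sets and the Helly property of subtrees *)

Definition walk_connected (G : graph) (S : G -> Prop) : Prop :=
  forall u v, S u -> S v ->
    exists2 p, is_walk u v p & forall w, w \in p -> S w.

Lemma walk_connectedU (T : graph) (S1 S2 : T -> Prop) t0 :
  walk_connected S1 -> walk_connected S2 -> S1 t0 -> S2 t0 ->
  walk_connected (fun t => S1 t \/ S2 t).
Proof.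
move=> h1 h2 S1t S2t.
have mid t : S1 t \/ S2 t ->
    (exists2 p, is_walk t t0 p & forall w, w \in p -> S1 w \/ S2 w) /\
    (exists2 p, is_walk t0 t p & forall w, w \in p -> S1 w \/ S2 w).
  case=> St.
    have [p hp Sp] := h1 t t0 St S1t; have [q hq Sq] := h1 t0 t S1t St.
    by split; [exists p|exists q] => // w; [move/Sp|move/Sq]; left.
  have [p hp Sp] := h2 t t0 St S2t; have [q hq Sq] := h2 t0 t S2t St.
  by split; [exists p|exists q] => // w; [move/Sp|move/Sq]; right.
move=> u v /mid [[p hp Sp] _] /mid [_ [q hq Sq]].
exists (p ++ q); first exact: walk_cat hp hq.
by move=> w; rewrite mem_cat => /orP [/Sp|/Sq].
Qed.

Section Helly.
Variable T : graph.
Hypothesis hT : is_tree T.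

Lemma tree_path (u v : T) : exists p, is_path u v p.
Proof. by case: hT => [[_ h] _]; apply: h. Qed.

Lemma walk_connected_convex (S : T -> Prop) u v p w :
  walk_connected S -> S u -> S v -> is_path u v p -> w \in u :: p -> S w.
Proof.
move=> cS Su Sv hp; rewrite inE => /predU1P [->//|hw].
have [q wq Sq] := cS u v Su Sv; apply: Sq.
by case: hT => _ hA; exact: (acyclic_path_sub_walk hA hp wq).
Qed.

(* Walking from X to Z inside Y, let m be the last node in X. If m is not in Z
   and m' follows m, then the path from m' to X `&` Z runs through m, although
   its ends are in Z. *)
Lemma helly3 (X Y Z : T -> Prop) :
  walk_connected X -> walk_connected Y -> walk_connected Z ->
  (exists t, X t /\ Y t) -> (exists t, Y t /\ Z t) -> (exists t, X t /\ Z t) ->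
  exists t, [/\ X t, Y t & Z t].
Proof.
move=> cX cY cZ [a [Xa Ya]] [b [Yb Zb]] [c [Xc Zc]].
have [p hp] := tree_path a b.
(* The path from [a] to [b] lies in the walk that goes to [c] inside [X] and on to [b] inside
   [Z]. *)
have XZp w : w \in a :: p -> X w \/ Z w.
  rewrite inE => /predU1P [->|hw]; first by left.
  have [q hq Xq] := cX a c Xa Xc; have [r hr Zr] := cZ c b Zc Zb.
  case: hT => _ hA; have := acyclic_path_sub_walk hA hp (walk_cat hq hr) hw.
  by rewrite mem_cat => /orP [/Xq|/Zr]; [left|right].
have Yp w : w \in a :: p -> Y w by apply: walk_connected_convex hp.
elim: p a hp XZp Yp Xa {Ya} => [|m' p IH] m hp XZp Yp Xm.
  exists m; split=> //; first by apply: Yp; rewrite mem_head.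
  by case/and3P: hp => _ _ /eqP /= ->.
case/and3P: (hp) => /= /andP [em pm] /andP [_ um] lm.
case: (pselect (X m')) => [Xm'|nXm'].
  have hp' : is_path m' b p by apply/and3P.
  by apply: (IH m') => // w hw; [apply: XZp|apply: Yp]; rewrite inE hw orbT.
have Zm' : Z m' by case: (XZp m') => //; rewrite !inE eqxx orbT.
have [q hq] := tree_path m c.
exists m; split=> //; first by apply: Yp; rewrite mem_head.
apply: (walk_connected_convex cZ Zm' Zc (p := m :: q)); last by rewrite !inE eqxx orbT.
case/and3P: (hq) => pq uq lq; apply/and3P; split=> //.
  by rewrite /= edge_sym em.
rewrite cons_uniq uq andbT; apply/negP => h; apply: nXm'.
exact: (walk_connected_convex cX Xm Xc hq h).
Qed.

End Helly.

(** * Distances in connected graphs as natural numbers *)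

Lemma gdist_ex (G : graph) (hG : connected_graph G) (u v : G) :
  exists n, `[< exists2 p, is_walk u v p & size p = n >].
Proof.
by case: hG => _ /(_ u v) [p /is_path_walk hp]; exists (size p); apply/asboolP; exists p.
Qed.

(** Minimizing over walks gives the same value as over paths, by [walk_shorten], and reduces the
    triangle inequality to concatenation. *)
Definition gdist (G : graph) (hG : connected_graph G) (u v : G) : nat :=
  ex_minn (gdist_ex hG u v).

Section Gdist.
Variable G : graph.
Hypothesis hG : connected_graph G.
Implicit Types (u v w : G) (p q : seq G).
Local Notation d := (gdist hG).

Lemma gdist_walk u v : exists2 p, is_walk u v p & size p = d u v.
Proof. by rewrite /gdist; case: ex_minnP => n /asboolP. Qed.

Lemma gdist_le u v p : is_walk u v p -> d u v <= size p.
Proof.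
move=> hp; rewrite /gdist; case: ex_minnP => n _; apply.
by apply/asboolP; exists p.
Qed.

Lemma gdistxx u : d u u = 0.
Proof. by have := gdist_le (walk_nil u); case: (d u u). Qed.

Lemma gdist_eq0 u v : d u v = 0 -> u = v.
Proof.
have [p /andP [_ /eqP <-] <-] := gdist_walk u v.
by move/size0nil->.
Qed.

Lemma gdist_sym u v : d u v = d v u.
Proof.
suff le x y : d x y <= d y x by apply/eqP; rewrite eqn_leq !le.
have [p /walk_rev [q [hq sq _]] <-] := gdist_walk y x.
by rewrite -sq gdist_le.
Qed.

Lemma gdist_triangle v u w : d u w <= d u v + d v w.
Proof.
have [p hp <-] := gdist_walk u v; have [q hq <-] := gdist_walk v w.
by rewrite -size_cat; apply/gdist_le/(walk_cat hp).
Qed.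

Lemma gdist_edge u v : edge u v -> d u v <= 1.
Proof. by move/walk1/gdist_le. Qed.

Lemma gdist_on_geodesic u v p w : is_walk u v p -> size p = d u v ->
  w \in u :: p -> d u w + d w v = d u v.
Proof.
move=> hp sp /(walk_split hp) [p1 [p2 [ep h1 h2]]].
apply/eqP; rewrite eqn_leq gdist_triangle andbT -sp ep size_cat.
by rewrite leq_add ?gdist_le.
Qed.

(** Take for [w] the last vertex before [v] on a geodesic. *)
Lemma gdist_pred u v : u != v -> exists2 w, edge w v & d u v = (d u w).+1.
Proof.
move=> nuv; have [p hp sp] := gdist_walk u v.
case/lastP: p hp sp => [/andP [_ /=]|p x hp sp]; first by rewrite (negPf nuv).
have hx : last u p \in u :: rcons p x by rewrite -rcons_cons mem_rcons inE mem_last orbT.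
have := gdist_on_geodesic hp sp hx.
case/andP: hp; rewrite rcons_path last_rcons => /andP [hp e] /eqP ex; subst x.
have := gdist_edge e.
have : d (last u p) v != 0.
  by apply/eqP => /gdist_eq0 E; move: e; rewrite E edge_irr.
by move=> d0 d1 dd; exists (last u p) => //; lia.
Qed.

End Gdist.

Lemma gdist_lipschitz (G H : graph) (hG : connected_graph G)
    (hH : connected_graph H) (f : G -> H) :
  (forall u v, edge u v -> gdist hH (f u) (f v) <= 1) ->
  forall u v, gdist hH (f u) (f v) <= gdist hG u v.
Proof.
move=> hf u v; have [p hp <-] := gdist_walk hG u v.
elim: p u hp => [|a p IH] u /andP [] /= => [_ /eqP ->|/andP [e pp] lp].
  by rewrite gdistxx.
apply: leq_trans (gdist_triangle hH (f a) _ _) _.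
by rewrite -add1n leq_add ?hf ?IH // /is_walk pp.
Qed.

(** * Trees defined by a parent map *)

Section ParentGraph.
Variables (V : choiceType) (par : V -> V).

(** A root may be its own parent; [x != y] suppresses the resulting loop. *)
Definition parent_edge : rel V :=
  fun x y => (x != y) && ((par x == y) || (par y == x)).

Lemma parent_edge_sym : symmetric parent_edge.
Proof. by move=> x y; rewrite /parent_edge eq_sym orbC. Qed.

Lemma parent_edge_irr : irreflexive parent_edge.
Proof. by move=> x; rewrite /parent_edge eqxx. Qed.

Definition parent_graph : graph := Graph parent_edge_sym parent_edge_irr.

(** The ends have a common ancestor, [a] and [b] generations up. Prepending a step up increments
    [a]; prepending a step down decrements [a], or increments [b] if [a] is 0. *)
Lemma parent_graph_walk (x y : parent_graph) p : is_walk x y p ->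
  exists a b, iter a par x = iter b par y /\ a + b <= size p.
Proof.
elim: p x => [|z p IH] x /andP [/=]; first by move=> _ /eqP ->; exists 0, 0.
move=> /andP [/andP [_ e] hp] lp.
have [|a [b [eab le]]] := IH z; first by rewrite /is_walk hp.
case/orP: e => /eqP e; first by exists a.+1, b; rewrite iterSr e addSn.
case: a eab le => [|a] eab le; first by exists 0, b.+1; rewrite iterS -eab /= e addnS.
by exists a, b; rewrite -eab iterSr e; split=> //; apply/leqW/(leq_trans _ le); lia.
Qed.

Lemma parent_graph_walk_par (x : parent_graph) :
  exists2 p, is_walk x (par x) p & size p <= 1.
Proof.
have [<-|n] := eqVneq x (par x); first by exists [::]; rewrite ?walk_nil.
exists [:: par x] => //; apply: (@walk1 parent_graph).
by apply/andP; rewrite eqxx.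
Qed.

(** Depth below the root: as the predecessor of 0 is 0, a vertex of level 0 is its own parent. *)
Variable lev : V -> nat.
Hypothesis lev_par : forall x, lev (par x) = (lev x).-1.
Hypothesis lev0_inj : forall x y, lev x = 0 -> lev y = 0 -> x = y.

Lemma parent_graph_connected : inhabited V -> connected_graph parent_graph.
Proof.
move=> hV; split=> // x y.
have down n : forall z : parent_graph, lev z = n ->
    exists r p, lev r = 0 /\ is_walk z r p.
  elim: n => [|n IH] z hz; first by exists z, [::]; rewrite walk_nil.
  have [|r [p [hr hp]]] := IH (par z); first by rewrite lev_par hz.
  have [q hq _] := parent_graph_walk_par z.
  by exists r, (q ++ p); split=> //; apply: walk_cat hp.
have [r [p [hr hp]]] := down _ x erefl.
have [r' [q [hr' hq]]] := down _ y erefl.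
have er := lev0_inj hr hr'; subst r'.
have [q' [hq' _ _]] := walk_rev hq.
by have [w [hw _ _]] := walk_shorten (walk_cat hp hq'); exists w.
Qed.

(* On a cycle, both neighbours of a vertex of maximal level would be its
   parent. *)
Lemma parent_graph_acyclic : acyclic parent_graph.
Proof.
move=> c sc /andP [cc uc].
have [x xc xmax] : exists2 x, x \in c & forall y, y \in c -> lev y <= lev x.
  have c0 : c != [::] by case: c sc {cc uc}.
  elim: c c0 {sc cc uc} => // x [|y c] IH _.
    by exists x; rewrite ?mem_head // => z; rewrite inE => /eqP ->.
  have [//|z zc zm] := IH.
  case: (leqP (lev x) (lev z)) => h.
    exists z; first by rewrite inE zc orbT.
    by move=> t; rewrite inE => /predU1P [->//|/zm].
  exists x; first by rewrite mem_head.
  move=> t; rewrite inE => /predU1P [->//|/zm] h'; lia.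
(* If [x] were the parent of [y], maximality would force both levels to be 0, hence [x = y]. *)
have nb y : y \in c -> parent_edge x y -> par x = y.
  move=> yc /andP [nxy /orP [/eqP //|/eqP e]].
  have := xmax y yc; have := lev_par y; rewrite e => h1 h2.
  by case/eqP: nxy; apply: lev0_inj; lia.
(* Once the cycle is rotated to start at [x], its second and last vertices are distinct neighbours
   of [x]. *)
have [i c' rc] := rot_to xc.
have mc y : y \in x :: c' -> y \in c by rewrite -rc mem_rot.
move: cc uc sc; rewrite -(rot_cycle i) -(rot_uniq i) -(size_rot i) rc.
case: c' {rc} mc => [//|y c'] mc; case/lastP: c' mc => [//|c' z] mc.
rewrite /cycle rcons_path => /andP [/= /andP [e1 _]].
rewrite last_rcons parent_edge_sym => e2 /and3P [_ /negP ny _] _; apply: ny.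
rewrite -(nb y) // ?(nb z) // ?mem_rcons ?mem_head //; apply: mc.
  by rewrite !inE mem_rcons mem_head !orbT.
by rewrite !inE eqxx orbT.
Qed.

Lemma parent_graph_tree : inhabited V -> is_tree parent_graph.
Proof.
by move=> hV; split; [apply: parent_graph_connected|apply: parent_graph_acyclic].
Qed.

End ParentGraph.

(** * Subtrees of a tree-decomposition met by walks *)

Section BagSubtrees.
Variables (G T : graph) (B : T -> set G).
Hypothesis hB : tree_decomposition B.

(** The bags containing one vertex form a subtree, and the subtrees of consecutive vertices share a
    bag that contains their edge. *)
Lemma bags_walk_connected u v p : is_walk u v p ->
  walk_connected (fun t => exists2 x, x \in u :: p & B t x).
Proof.
have [hT _ hE hI] := hB.
have one x : walk_connected (fun t => B t x).
  move=> t t' Bt Bt'; have [q hq] := tree_path hT t t'.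
  exists q; first exact: is_path_walk.
  by move=> w hw; apply: (hI t w t' q) => //; rewrite inE hw orbT.
elim: p u => [|a p IH] u.
  move=> _ t t' [x]; rewrite inE => /eqP -> Bt [x']; rewrite inE => /eqP -> Bt'.
  have [q hq Bq] := one u t t' Bt Bt'; exists q => // w /Bq; exists u => //.
  exact: mem_head.
move=> /andP [/= /andP [e pp] lp].
have [t0 [Bu Ba]] := hE u a e.
have hap : is_walk a v p by rewrite /is_walk pp.
have h2 : exists2 x, x \in a :: p & B t0 x by exists a; rewrite ?mem_head.
have := walk_connectedU (one u) (IH a hap) Bu h2.
have sub t : (exists2 x, x \in u :: a :: p & B t x) ->
   B t u \/ (exists2 x, x \in a :: p & B t x).
  by case=> x; rewrite inE => /predU1P [->|hx] Bx; [left|right; exists x].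
have sup t : B t u \/ (exists2 x, x \in a :: p & B t x) ->
   (exists2 x, x \in u :: a :: p & B t x).
  case=> [Bt|[x hx Bx]]; first by exists u; rewrite ?mem_head.
  by exists x => //; rewrite inE hx orbT.
move=> h t t' /sub ht /sub ht'; have [q hq Bq] := h t t' ht ht'.
by exists q => // w /Bq /sup.
Qed.

(** Any two of the walks share an end, so their subtrees share a bag containing it; [helly3] then
    gives a bag common to all three. *)
Lemma bag_meets_walk_triangle u v w p q r :
  is_walk u v p -> is_walk v w q -> is_walk u w r ->
  exists t, [/\ exists2 x, x \in u :: p & B t x,
                exists2 x, x \in v :: q & B t x
              & exists2 x, x \in u :: r & B t x].
Proof.
move=> hp hq hr; have [hT hC _ _] := hB.
have cov x : exists t, B t x.
  have [t _ Bt] : (\bigcup_t B t)%classic x by rewrite hC.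
  by exists t.
have ends x y s : is_walk x y s -> y \in x :: s.
  by case/andP=> _ /eqP <-; apply: mem_last.
have [tu Bu] := cov u; have [tv Bv] := cov v; have [tw Bw] := cov w.
have [cp cq cr] := And3 (bags_walk_connected hp) (bags_walk_connected hq)
  (bags_walk_connected hr).
apply: (helly3 hT cp cq cr).
- by exists tv; split; exists v => //; [exact: ends hp|exact: mem_head].
- exists tw; split; exists w => //; [exact: ends hq|exact: ends hr].
- by exists tu; split; exists u => //; exact: mem_head.
Qed.

End BagSubtrees.

(** * The tree of clusters and its metric *)

Section Layering.
Variables (G : graph) (hG : connected_graph G) (s : G).
Implicit Types (u v w : G) (p q : seq G).
Local Notation d := (gdist hG).
Local Notation lev := (gdist hG s).

Definition same_cluster u v : Prop :=
  lev u = lev v /\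
  exists2 p, is_walk u v p & forall w, w \in u :: p -> lev u <= lev w.

Lemma same_cluster_refl u : same_cluster u u.
Proof.
by split=> //; exists [::]; [apply: walk_nil|move=> w; rewrite inE => /eqP ->].
Qed.

Lemma same_cluster_sym u v : same_cluster u v -> same_cluster v u.
Proof.
case=> l [p /walk_rev [q [hq _ mq]] hp]; split=> //; exists q => // w.
by rewrite mq -l; apply: hp.
Qed.

Lemma same_cluster_trans u v w :
  same_cluster u v -> same_cluster v w -> same_cluster u w.
Proof.
case=> luv [p hp lp] [lvw [q hq lq]]; split; first by rewrite luv.
exists (p ++ q); first exact: walk_cat hp hq.
move=> x; rewrite -cat_cons mem_cat => /orP [/lp //|hx].
by rewrite luv; apply: lq; rewrite inE hx orbT.
Qed.

Lemma lev_edge u v : edge u v -> lev v <= (lev u).+1.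
Proof.
move=> /(gdist_edge hG) h; apply: leq_trans (gdist_triangle hG u _ _) _; lia.
Qed.

Lemma same_cluster_edge u v : edge u v -> lev u = lev v -> same_cluster u v.
Proof.
move=> e l; split=> //; exists [:: v]; first exact: walk1.
by move=> w; rewrite !inE => /orP [] /eqP ->; rewrite ?l.
Qed.

(** An arbitrary neighbour closer to [s]; the default [v] is taken only at [v = s]. *)
Definition par v : G := xget v [set w | edge w v /\ lev v = (lev w).+1]%classic.

Lemma parP v : v != s -> edge (par v) v /\ lev v = (lev (par v)).+1.
Proof.
rewrite eq_sym => /(gdist_pred hG) [w e l]; rewrite /par; case: xgetP => [_ -> //|].
by move/(_ w); case.
Qed.

Lemma par_root : par s = s.
Proof. by rewrite /par; case: xgetP => // w _ []; rewrite gdistxx. Qed.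

Lemma lev_par v : lev (par v) = (lev v).-1.
Proof.
have [->|/parP [_ -> //]] := eqVneq v s; by rewrite par_root gdistxx.
Qed.

Lemma gdist_par v : d v (par v) <= 1.
Proof.
have [->|/parP [e _]] := eqVneq v s; first by rewrite par_root gdistxx.
by apply: gdist_edge; rewrite edge_sym.
Qed.

(** Prolonging the walk to both parents lowers its minimal level by just one. The root is alone in
    its cluster. *)
Lemma same_cluster_par u v : same_cluster u v -> same_cluster (par u) (par v).
Proof.
have [->|nu] := eqVneq u s.
  by case; rewrite gdistxx => /esym /gdist_eq0 <- _; apply: same_cluster_refl.
have [eu lu] := parP nu.
case=> l [p hp lp].
have nv : v != s by apply/eqP => ev; move: l; rewrite ev gdistxx lu.
have [ev lv] := parP nv.
have lpuv : lev (par u) = lev (par v) by lia.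
split=> //; exists ((u :: p) ++ [:: par v]).
  apply: walk_cat (walk1 _); last by rewrite edge_sym; exact: ev.
  by case/andP: hp => hp hl; rewrite /is_walk /= eu hp.
move=> w; rewrite inE mem_cat => /or3P [/eqP -> //|/lp|]; first lia.
by rewrite inE => /eqP ->; rewrite lpuv.
Qed.

(** The walk [u], [v], [par v] is a witness. Hence the parent cluster does not depend on the choice
    made in [par]. *)
Lemma same_cluster_up u v : edge u v -> lev v = (lev u).+1 ->
  same_cluster u (par v).
Proof.
move=> e l.
have nv : v != s by apply/eqP => ev; move: l; rewrite ev gdistxx.
have [ev lv] := parP nv; have luv : lev u = lev (par v) by lia.
split=> //; exists ([:: v] ++ [:: par v]).
  by apply: walk_cat (walk1 e) (walk1 _); rewrite edge_sym.
move=> w; rewrite !inE => /or3P [] /eqP -> //; lia.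
Qed.

(** The default [s] is never taken, but being independent of [v] it lets [eq_rep] follow from the
    equality of the classes as predicates. *)
Definition rep v : G := xget s (same_cluster v).

Lemma repP v : same_cluster v (rep v).
Proof.
rewrite /rep; case: xgetP => [_ -> //|/(_ v) []]; exact: same_cluster_refl.
Qed.

Lemma eq_rep u v : same_cluster u v -> rep u = rep v.
Proof.
move=> h; rewrite /rep; congr xget; apply/funext => w; apply/propext; split.
  by apply: same_cluster_trans; apply: same_cluster_sym.
exact: same_cluster_trans.
Qed.

Lemma rep_idem v : rep (rep v) == rep v.
Proof. by apply/eqP/esym/eq_rep/repP. Qed.

(** The quotient by [same_cluster], realized as a subtype of [G] so that it is again a
    choiceType. *)
Definition cluster := {v : G | rep v == v}.

Definition to_cluster v : cluster := exist _ (rep v) (rep_idem v).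

Lemma to_clusterP u v : to_cluster u = to_cluster v <-> same_cluster u v.
Proof.
split=> [[e]|/eq_rep e]; last exact: val_inj.
apply: same_cluster_trans (repP u) _; rewrite e; exact/same_cluster_sym/repP.
Qed.

Lemma to_cluster_val (x : cluster) : to_cluster (val x) = x.
Proof. by apply: val_inj; apply/eqP; exact: (valP x). Qed.

Definition cluster_par (x : cluster) : cluster := to_cluster (par (val x)).

Lemma cluster_par_to_cluster v : cluster_par (to_cluster v) = to_cluster (par v).
Proof.
by apply/to_clusterP/same_cluster_par/same_cluster_sym/repP.
Qed.

Definition cluster_tree : graph := parent_graph cluster_par.

Lemma cluster_tree_tree : is_tree cluster_tree.
Proof.
apply: (@parent_graph_tree _ _ (fun x : cluster => lev (val x))).
- by move=> x; rewrite -lev_par; case: (repP (par (val x))) => <-.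
- by move=> x y /gdist_eq0 ex /gdist_eq0 ey; apply: val_inj; rewrite -ex.
- exact: (inhabits (to_cluster s)).
Qed.

Local Notation dT := (gdist cluster_tree_tree.1).
Local Notation phi := (to_cluster : G -> cluster_tree).

(** An edge inside a level collapses to one cluster; an edge between consecutive levels goes to a
    cluster and its parent. *)
Lemma cluster_tree_contract u v : dT (phi u) (phi v) <= d u v.
Proof.
apply: gdist_lipschitz => {}u {}v e.
wlog le : u v e / lev u <= lev v.
  move=> h; case: (leqP (lev u) (lev v)) => [|/ltnW le]; first exact: h.
  by rewrite gdist_sym; apply: h => //; rewrite edge_sym.
have := lev_edge e; rewrite leq_eqVlt ltnS => /orP [/eqP l|ge].
  have /to_clusterP -> := same_cluster_up e l.
  rewrite -cluster_par_to_cluster gdist_sym.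
  have [p hp] := parent_graph_walk_par (phi v).
  by apply: leq_trans; apply: gdist_le.
have /to_clusterP -> : same_cluster u v by apply: same_cluster_edge => //; lia.
by rewrite gdistxx.
Qed.

Lemma gdist_iter_par v n : d v (iter n par v) <= n.
Proof.
elim: n => [|n IH]; first by rewrite gdistxx.
apply: leq_trans (gdist_triangle hG (iter n par v) _ _) _.
by have := gdist_par (iter n par v); rewrite iterS; lia.
Qed.

Lemma iter_cluster_par n v :
  iter n cluster_par (to_cluster v) = to_cluster (iter n par v).
Proof. by elim: n => //= n ->; rewrite cluster_par_to_cluster. Qed.

(** Going up [a] steps from [u] and [b] steps from [v] in [G] ends in a common cluster, so
    [d u v <= a + D + b]. *)
Lemma cluster_tree_expand D : (forall u v, same_cluster u v -> d u v <= D) ->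
  forall u v, d u v <= dT (phi u) (phi v) + D.
Proof.
move=> hD u v; have [p hp <-] := gdist_walk cluster_tree_tree.1 (phi u) (phi v).
have [a [b []]] := parent_graph_walk hp; rewrite !iter_cluster_par.
move=> /to_clusterP /hD h le; apply: leq_trans (leq_add le (leqnn D)).
have := gdist_triangle hG (iter a par u) u v.
have := gdist_triangle hG (iter b par v) (iter a par u) v.
have := gdist_iter_par u a; have := gdist_iter_par v b.
rewrite (gdist_sym hG v) => *; lia.
Qed.

(* Geodesics from s to u and to v and a walk from u to v outside the ball around
   s of radius [lev u - 1] all meet one bag, in a, b and c say. As
   [lev u <= lev c <= lev a + k], the vertex a is within k of u, and likewise b
   is within k of v. *)
Lemma same_cluster_gdist (T : graph) (B : T -> set G) k :
  tree_decomposition B ->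
  (forall t u v, B t u -> B t v -> d u v <= k) ->
  forall u v, same_cluster u v -> d u v <= 3 * k.
Proof.
move=> hB hk u v [l [q hq lq]].
have [p hp sp] := gdist_walk hG s u; have [r hr sr] := gdist_walk hG s v.
have [t [[a ha Ba] [c /lq hc Bc] [b hb Bb]]] := bag_meets_walk_triangle hB hp hq hr.
have := gdist_on_geodesic hp sp ha; have := gdist_on_geodesic hr sr hb.
have := gdist_triangle hG a s c; have := gdist_triangle hG b s c.
have := hk _ _ _ Ba Bc; have := hk _ _ _ Bb Bc; have := hk _ _ _ Ba Bb.
(* The route from [u] through [a] and [b] to [v] has three legs of length at most [k]. *)
have := gdist_triangle hG a u v; have := gdist_triangle hG b a v.
rewrite (gdist_sym hG u a) => *; lia.
Qed.

End Layering.

(** * Passage from extended real to natural distances *)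

Section ExtendedDist.
Variable R : realType.
Local Open Scope ring_scope.
Local Open Scope ereal_scope.

Lemma dist_gdist (G : graph) (hG : connected_graph G) (u v : G) :
  dist R u v = (gdist hG u v)%:R%:E.
Proof.
apply/eqP; rewrite eq_le; apply/andP; split.
  have [p hp sp] := gdist_walk hG u v; have [q [hq sq _]] := walk_shorten hp.
  apply: (@le_trans _ _ (size q)%:R%:E); first by apply: ereal_inf_lbound; exists q.
  by rewrite lee_fin ler_nat -sp.
apply: le_ereal_inf_tmp => _ [p hp <-].
by rewrite lee_fin ler_nat; apply/gdist_le/is_path_walk.
Qed.

(* Thanks to the factor 2, the infimum defining [odw] need not be attained. *)
Lemma odw_bounded_bags (G : graph) (hG : connected_graph G) :
  odw R G \is a fin_num -> exists (T : graph) (B : T -> set G) (k : nat),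
    [/\ tree_decomposition B,
        forall t u v, B t u -> B t v -> (gdist hG u v <= k)%N
      & (k%:R <= 2 * fine (odw R G))%R].
Proof.
move=> hfin.
have bag (T : graph) (B : T -> set G) t u v : B t u -> B t v ->
    (gdist hG u v)%:R%:E <= outer_diameter R B.
  move=> Bu Bv; rewrite -dist_gdist.
  apply: (@le_trans _ _ (ereal_sup [set dist R u v | u in B t & v in B t]%classic)).
    by apply: ereal_sup_ubound; exists u => //; exists v.
  by apply: ereal_sup_ubound; exists t.
have near (x : R) : odw R G < x%:E -> exists (T : graph) (B : T -> set G),
    tree_decomposition B /\
    forall t u v, B t u -> B t v -> ((gdist hG u v)%:R < x)%R.
  rewrite {1}/odw => /ereal_inf_lt [_ [T [B [hB ->]]] ltx].
  exists T, B; split=> // t u v Bu Bv.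
  by rewrite -lte_fin; apply: le_lt_trans ltx; apply: bag Bu Bv.
have [s] : inhabited G by case: (hG).
have ge0 : 0 <= odw R G.
  apply: le_ereal_inf_tmp => _ [T [B [[_ hC _ _] ->]]].
  have [t _ Bt] : (\bigcup_t B t)%classic s by rewrite hC.
  by have := bag _ _ _ _ _ Bt Bt; rewrite gdistxx.
have e := fineK hfin; set r := fine (odw R G) in e *.
have r0 : (0 <= r)%R by rewrite -lee_fin e.
(* If [r] is 0, then [2 * r] does not exceed it, so 1 serves as strict bound: natural distances
   below 1 vanish. *)
move: r0; rewrite le_eqVlt => /predU1P [r0|r0].
  have [|T [B [hB hk]]] := near 1%R; first by rewrite -e lte_fin -r0.
  exists T, B, 0%N; split=> //; last by rewrite -r0 mulr0.
  by move=> t u v Bu Bv; rewrite -ltnS -(ltr_nat R); apply: hk Bu Bv.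
have [|T [B [hB hk]]] := near (2 * r)%R.
  by rewrite -e lte_fin ltr_pMl // ltr1n.
have r20 : (0 <= 2 * r)%R by rewrite mulr_ge0 // ltW.
(* Natural distances below [2 * r] are at most its integer part. *)
exists T, B, (Num.truncn (2 * r)%R); split=> //; last first.
  by rewrite truncn_le.
by move=> t u v Bu Bv; rewrite truncn_ge_nat // ltW // (hk t).
Qed.

End ExtendedDist.

(** * The quasi-isometry onto the cluster tree *)

Local Open Scope ring_scope.
Local Open Scope ereal_scope.

Theorem theorem4p1 (R : realType) (G : graph) (hG : connected_graph G)
    (hfin : odw R G \is a fin_num) :
  (exists (T : graph) (phi : G -> T),
     is_tree T /\ quasi_isometry 1%R (6%:R * fine (odw R G))%R phi) /\
  ad R G <= 6%:R%:E * odw R G.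
Proof.
have [T0 [B [k [hB hk kr]]]] := odw_bounded_bags hG hfin.
have [s] : inhabited G by case: (hG).
pose T := cluster_tree hG s; pose phi : G -> T := to_cluster hG s.
pose hT : is_tree T := cluster_tree_tree hG s.
set C := (6%:R * fine (odw R G))%R.
(* Clusters have diameter at most [3 * k], and [k] is at most twice [odw R G]. *)
have kC : ((3 * k)%:R <= C)%R by rewrite /C natrM; lra.
have C0 : (0 <= C)%R by apply: le_trans kC.
have up u v : dist R (phi u) (phi v) <= dist R u v + C%:E.
  rewrite (dist_gdist R hG) (dist_gdist R hT.1) -EFinD lee_fin.
  have := cluster_tree_contract hG s u v; rewrite -(ler_nat R) => h.
  by apply: le_trans h _; rewrite lerDl.
have lo u v : dist R u v <= dist R (phi u) (phi v) + C%:E.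
  rewrite (dist_gdist R hG) (dist_gdist R hT.1) -EFinD lee_fin.
  have := cluster_tree_expand (same_cluster_gdist (s:=s) hB hk) u v.
  by rewrite -(ler_nat R) natrD => /le_trans; apply; rewrite lerD2l.
split.
  exists T, phi; split=> //; split=> [u v|y].
    rewrite invr1 !mul1e; split; last exact: up.
    by rewrite leeBlDr // lo.
  (* The projection is onto: a cluster is the image of its representative. *)
  exists (val y); rewrite /phi to_cluster_val (dist_gdist R hT.1) gdistxx.
  by rewrite lee_fin.
apply: (@le_trans _ _ C%:E); last by rewrite /C EFinM fineK.
apply: ereal_inf_lbound; exists T, phi; split=> //.
apply: ge_ereal_sup => _ [u _ [v _ <-]].
have := up u v; have := lo u v.
rewrite (dist_gdist R hG) (dist_gdist R hT.1) -!EFinD !lee_fin => h1 h2.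
by rewrite ler_norml; lra.
Qed.
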